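(* Let $k$ be a positive integer and let $G$ be a $\mathrm{CSN}_k$ group which is not nilpotent. Then $G$ is a domain (i.e. an equational domain).
   Context: Conventions: $a^x=x^{-1}ax$ and $H^x=x^{-1}Hx$. Simple commutators $[x_1,x_2,\ldots,x_{k+1}]$ are left-normed (left aligned). For a positive integer $k$, a group is called nilpotent of class $k$ if the identity $[x_1,x_2,\ldots,x_{k+1}]=1$ holds in it (so the class is at most $k$ in the usual terminology). ''Not nilpotent'' means not nilpotent of any class. A subgroup $H\leq G$ is malnormal if $H\cap H^x=1$ for every $x\in G\setminus H$. A group $G$ is $\mathrm{CSN}_k$ (conjugately separated nilpotent of class $k$) if every maximal element (with respect to inclusion) of the set of class $k$ nilpotent subgroups of $G$ is malnormal in $G$. For $X=\{x_1,\ldots,x_n\}$, let $G[X]=G\ast\mathbb{F}[X]$ be the free product of $G$ with the free group $\mathbb{F}[X]$ on $X$; its elements are group words $w(x_1,\ldots,x_n)$ in the variables with coefficients from $G$. For $S\subseteq G[X]$, put $V_G(S)=\{(g_1,\ldots,g_n)\in G^n : w(g_1,\ldots,g_n)=1 \text{ for all } w\in S\}$. Subsets of $G^n$ of this form are called algebraic sets. The group $G$ is a domain (equational domain) if for every positive integer $n$, the union of any two algebraic sets in $G^n$ is again an algebraic set. *)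

(* Defs.v *)
From HB Require Import structures.
From mathcomp Require Import all_boot.
From mathcomp Require Import boolp classical_sets.

Set Implicit Arguments.
Unset Strict Implicit.
Unset Printing Implicit Defensive.

Local Open Scope classical_set_scope.
Local Open Scope group_scope.
Local Open Scope quotient_scope.

Section Presentation.
Variables (T : choiceType) (R : seq (T * bool) -> seq (T * bool) -> Prop).

(* A word is a sequence of letters (t, b), read as t if b and as the formal
   inverse of t otherwise. *)
Local Notation word := (seq (T * bool)).

Inductive word_eq : word -> word -> Prop :=
| word_eq_refl u : word_eq u u
| word_eq_sym u v : word_eq u v -> word_eq v u
| word_eq_trans v u w : word_eq u v -> word_eq v w -> word_eq u w
| word_eq_cancel u v t b : word_eq (u ++ (t, b) :: (t, ~~ b) :: v) (u ++ v)
| word_eq_rel u v r s : R r s -> word_eq (u ++ r ++ v) (u ++ s ++ v).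

Definition word_eqb (u v : word) : bool := `[< word_eq u v >].

Lemma word_eqb_refl : reflexive word_eqb.
Proof. by move=> u; apply/asboolP; constructor. Qed.

Lemma word_eqb_sym : symmetric word_eqb.
Proof. by move=> u v; apply: asbool_equiv_eq; split; apply: word_eq_sym. Qed.

Lemma word_eqb_trans : transitive word_eqb.
Proof.
by move=> v u w /asboolP uv /asboolP vw; apply/asboolP; apply: word_eq_trans vw.
Qed.

Canonical word_equiv :=
  EquivRel word_eqb word_eqb_refl word_eqb_sym word_eqb_trans.

(* The group presented by the generators T and the relations r = s for R r s. *)
Definition presented := {eq_quot word_equiv}.
HB.instance Definition _ := Choice.on presented.

Definition pres_class (u : word) : presented := \pi_presented u.
Definition pres_gen (t : T) : presented := pres_class [:: (t, true)].

Definition inv_word (u : word) : word := rev [seq (l.1, ~~ l.2) | l <- u].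

Definition pres_one : presented := pres_class [::].
Definition pres_mul (x y : presented) : presented :=
  pres_class (repr x ++ repr y).
Definition pres_inv (x : presented) : presented :=
  pres_class (inv_word (repr x)).

Lemma pres_classP u v : word_eq u v <-> pres_class u = pres_class v.
Proof.
rewrite /pres_class; split=> [uv|]; first by apply/eqmodP/asboolP.
by move/eqmodP/asboolP.
Qed.

Lemma pres_classK x : pres_class (repr x) = x.
Proof. exact: reprK. Qed.

Lemma word_eq_repr u : word_eq (repr (pres_class u)) u.
Proof. by apply/pres_classP; rewrite pres_classK. Qed.

Lemma word_eq_cat2l w u v : word_eq u v -> word_eq (w ++ u) (w ++ v).
Proof.
elim=> {u v} [u|u v _|v u t _ uv _|u v t b|u v r s rs]; try by constructor.
- exact: word_eq_trans uv.
- by rewrite !catA; constructor.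
- by rewrite !(catA w); constructor.
Qed.

Lemma word_eq_cat2r w u v : word_eq u v -> word_eq (u ++ w) (v ++ w).
Proof.
elim=> {u v} [u|u v _|v u t _ uv _|u v t b|u v r s rs]; try by constructor.
- exact: word_eq_trans uv.
- by rewrite -!catA /=; constructor.
- by rewrite -!catA; constructor.
Qed.

Lemma word_eq_cat u u' v v' :
  word_eq u u' -> word_eq v v' -> word_eq (u ++ v) (u' ++ v').
Proof.
move=> uu' vv'; apply: (@word_eq_trans (u' ++ v)).
  exact: word_eq_cat2r.
exact: word_eq_cat2l.
Qed.

Lemma inv_word_cons l u : inv_word (l :: u) = inv_word u ++ [:: (l.1, ~~ l.2)].
Proof. by rewrite /inv_word /= rev_cons -cats1. Qed.

Lemma inv_word_cat u v : inv_word (u ++ v) = inv_word v ++ inv_word u.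
Proof. by rewrite /inv_word map_cat rev_cat. Qed.

Lemma inv_wordK : involutive inv_word.
Proof.
move=> u; rewrite /inv_word map_rev revK -map_comp map_id_in // => -[t b] _.
by rewrite /= negbK.
Qed.

Lemma word_eq_mulV u : word_eq (u ++ inv_word u) [::].
Proof.
elim: u => [|[t b] u IH]; first exact: word_eq_refl.
rewrite inv_word_cons -cat1s catA -(catA [:: _]).
apply: (@word_eq_trans ([:: (t, b)] ++ [::] ++ [:: (t, ~~ b)])).
  by rewrite -catA; apply/word_eq_cat2l/word_eq_cat2r.
exact: (word_eq_cancel [::] [::]).
Qed.

Lemma word_eq_mulVw u : word_eq (inv_word u ++ u) [::].
Proof. by rewrite -{2}(inv_wordK u); apply: word_eq_mulV. Qed.

Lemma pres_classM u v : pres_mul (pres_class u) (pres_class v) = pres_class (u ++ v).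
Proof. by apply/pres_classP; apply: word_eq_cat; apply: word_eq_repr. Qed.

Lemma pres_mulA : associative pres_mul.
Proof.
move=> x y z; rewrite -[x]pres_classK -[y]pres_classK -[z]pres_classK.
by rewrite !pres_classM catA.
Qed.

Lemma pres_mul1 : left_id pres_one pres_mul.
Proof. by move=> x; rewrite -[x]pres_classK pres_classM. Qed.

Lemma pres_mulr1 : right_id pres_one pres_mul.
Proof. by move=> x; rewrite -[x]pres_classK pres_classM cats0. Qed.

Lemma pres_mulV : left_inverse pres_one pres_inv pres_mul.
Proof.
move=> x; rewrite -{2}[x]pres_classK pres_classM.
by apply/pres_classP/word_eq_mulVw.
Qed.

Lemma pres_mulrV : right_inverse pres_one pres_inv pres_mul.
Proof.
move=> x; rewrite -{1}[x]pres_classK pres_classM.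
by apply/pres_classP/word_eq_mulV.
Qed.

HB.instance Definition _ := isGroup.Build presented
  pres_mulA pres_mul1 pres_mulr1 pres_mulV pres_mulrV.

Lemma pres_class_cat u v : pres_class (u ++ v) = pres_class u * pres_class v.
Proof. by rewrite -pres_classM. Qed.

Lemma pres_class_rel r s : R r s -> pres_class r = pres_class s.
Proof.
move=> rs; apply/pres_classP.
by have := word_eq_rel [::] [::] rs; rewrite /= !cats0.
Qed.

Variable K : groupType.

Definition eval_letter (f : T -> K) (l : T * bool) : K :=
  if l.2 then f l.1 else (f l.1)^-1.
Definition eval_word (f : T -> K) (u : word) : K :=
  \prod_(l <- u) eval_letter f l.

(* Well defined (independent of the representative) when f respects R; see
   pres_lift_class. *)
Definition pres_lift (f : T -> K) (x : presented) : K := eval_word f (repr x).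

Lemma eval_word_cat f u v : eval_word f (u ++ v) = eval_word f u * eval_word f v.
Proof. exact: big_cat. Qed.

Lemma eval_word_eq f u v :
  (forall r s, R r s -> eval_word f r = eval_word f s) ->
  word_eq u v -> eval_word f u = eval_word f v.
Proof.
move=> fR; elim=> {u v} [//|u v _ -> //|v u w _ -> _ //|u v t b|u v r s rs].
- rewrite !eval_word_cat; congr (_ * _).
  rewrite /eval_word !big_cons mulgA /eval_letter /=.
  by case: b; rewrite /= ?mulgV ?mulVg mul1g.
- by rewrite !eval_word_cat (fR _ _ rs).
Qed.

Section Lift.
Variable f : T -> K.
Hypothesis fR : forall r s, R r s -> eval_word f r = eval_word f s.

Lemma pres_lift_class u : pres_lift f (pres_class u) = eval_word f u.
Proof. exact/(eval_word_eq fR)/word_eq_repr. Qed.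

Lemma pres_liftM x y : pres_lift f (x * y) = pres_lift f x * pres_lift f y.
Proof.
by rewrite -[x]pres_classK -[y]pres_classK -pres_class_cat !pres_lift_class
  eval_word_cat.
Qed.

Lemma pres_lift_gen t : pres_lift f (pres_gen t) = f t.
Proof. by rewrite pres_lift_class /eval_word big_seq1. Qed.

End Lift.

Lemma pres_hom_ext (phi psi : presented -> K) :
  {morph phi : x y / x * y} -> {morph psi : x y / x * y} ->
  (forall t, phi (pres_gen t) = psi (pres_gen t)) -> phi =1 psi.
Proof.
move=> phiM psiM eqg.
have hom1 (h : presented -> K) : {morph h : x y / x * y} -> h 1 = 1.
  by move=> hM; apply: (mulgI (h 1)); rewrite -hM !mulg1.
have homV (h : presented -> K) (hM : {morph h : x y / x * y}) x :
    h x^-1 = (h x)^-1.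
  by apply: (mulgI (h x)); rewrite -hM !mulgV hom1.
move=> x; rewrite -[x]pres_classK; elim: (repr x) => [|[t b] u IH].
  by rewrite -[pres_class [::]]/(1 : presented) !hom1.
rewrite -cat1s pres_class_cat phiM psiM IH; congr (_ * _).
case: b; first exact: eqg.
have -> : pres_class [:: (t, false)] = (pres_gen t)^-1.
  apply: (mulgI (pres_gen t)); rewrite mulgV -pres_class_cat.
  exact/pres_classP/(word_eq_cancel [::] [::] t true).
by rewrite !homV // eqg.
Qed.

End Presentation.

Section FreeGroup.
Variable X : choiceType.

Definition free_rel (r s : seq (X * bool)) : Prop := False.
Definition free_group := presented free_rel.
HB.instance Definition _ := Group.on free_group.

Definition free_var (x : X) : free_group := pres_gen free_rel x.

Definition free_lift (K : groupType) (f : X -> K) : free_group -> K :=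
  pres_lift f.

Lemma free_liftM (K : groupType) (f : X -> K) :
  {morph free_lift f : x y / x * y}.
Proof. exact: pres_liftM. Qed.

Lemma free_lift_var (K : groupType) (f : X -> K) x :
  free_lift f (free_var x) = f x.
Proof. exact: pres_lift_gen. Qed.

Lemma free_hom_ext (K : groupType) (phi psi : free_group -> K) :
  {morph phi : x y / x * y} -> {morph psi : x y / x * y} ->
  (forall x, phi (free_var x) = psi (free_var x)) -> phi =1 psi.
Proof. exact: pres_hom_ext. Qed.

End FreeGroup.

Section FreeProduct.
Variables G H : groupType.

(* The multiplication tables of G and H. *)
Inductive free_product_rel : seq ((G + H) * bool) -> seq ((G + H) * bool) -> Prop :=
| free_product_rel_l g g' : free_product_rel
    [:: (inl g, true); (inl g', true)] [:: (inl (g * g'), true)]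
| free_product_rel_r h h' : free_product_rel
    [:: (inr h, true); (inr h', true)] [:: (inr (h * h'), true)].

Definition free_product := presented free_product_rel.
HB.instance Definition _ := Group.on free_product.

Definition fprod_inl (g : G) : free_product :=
  pres_gen free_product_rel (inl g : (G + H)%type).
Definition fprod_inr (h : H) : free_product :=
  pres_gen free_product_rel (inr h : (G + H)%type).

Lemma fprod_inlM : {morph fprod_inl : x y / x * y}.
Proof.
move=> g g'; rewrite -[RHS]pres_class_cat; symmetry; apply: pres_class_rel.
by constructor.
Qed.

Lemma fprod_inrM : {morph fprod_inr : x y / x * y}.
Proof.
move=> h h'; rewrite -[RHS]pres_class_cat; symmetry; apply: pres_class_rel.
by constructor.
Qed.

Definition fprod_fun (K : Type) (f : G -> K) (g : H -> K) (x : G + H) : K :=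
  match x with inl a => f a | inr b => g b end.

Definition fprod_lift (K : groupType) (f : G -> K) (g : H -> K) :
  free_product -> K := pres_lift (fprod_fun f g).

Section Lift.
Variables (K : groupType) (f : G -> K) (g : H -> K).
Hypotheses (fM : {morph f : x y / x * y}) (gM : {morph g : x y / x * y}).

Let rel_fprod_fun r s : free_product_rel r s ->
  eval_word (fprod_fun f g) r = eval_word (fprod_fun f g) s.
Proof.
by case=> x y; rewrite /eval_word big_cons !big_seq1 /eval_letter /= ?fM ?gM.
Qed.

Lemma fprod_liftM : {morph fprod_lift f g : x y / x * y}.
Proof. exact: pres_liftM. Qed.

Lemma fprod_lift_inl a : fprod_lift f g (fprod_inl a) = f a.
Proof. exact: pres_lift_gen. Qed.

Lemma fprod_lift_inr b : fprod_lift f g (fprod_inr b) = g b.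
Proof. exact: pres_lift_gen. Qed.

End Lift.

Lemma fprod_hom_ext (K : groupType) (phi psi : free_product -> K) :
  {morph phi : x y / x * y} -> {morph psi : x y / x * y} ->
  (forall a, phi (fprod_inl a) = psi (fprod_inl a)) ->
  (forall b, phi (fprod_inr b) = psi (fprod_inr b)) -> phi =1 psi.
Proof. by move=> phiM psiM eql eqr; apply: pres_hom_ext => // -[]. Qed.

End FreeProduct.

Section EquationalDomain.
Variable G : groupType.

Definition group_words (n : nat) := free_product G (free_group 'I_n).
HB.instance Definition _ n := Group.on (group_words n).

Definition coefficient n (a : G) : group_words n := fprod_inl _ a.
Definition variable n (i : 'I_n) : group_words n := fprod_inr G (free_var i).

(* The value w(g_1, ..., g_n): the morphism that fixes G and maps x_i to g_i. *)
Definition word_value n (g : {ffun 'I_n -> G}) : group_words n -> G :=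
  fprod_lift idfun (free_lift g).

Lemma word_valueM n (g : {ffun 'I_n -> G}) :
  {morph word_value g : v w / v * w}.
Proof. by apply: fprod_liftM => //; apply: free_liftM. Qed.

Lemma word_value_coefficient n (g : {ffun 'I_n -> G}) a :
  word_value g (coefficient n a) = a.
Proof. by apply: fprod_lift_inl => //; apply: free_liftM. Qed.

Lemma word_value_variable n (g : {ffun 'I_n -> G}) i :
  word_value g (variable i) = g i.
Proof.
rewrite /word_value fprod_lift_inr ?free_lift_var //; exact: free_liftM.
Qed.

Definition solutions n (S : set (group_words n)) : set {ffun 'I_n -> G} :=
  [set g | forall w, S w -> word_value g w = 1].

Definition algebraic n (A : set {ffun 'I_n -> G}) : Prop :=
  exists S : set (group_words n), A = solutions S.

Definition equational_domain : Prop :=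
  forall n, (0 < n)%N -> forall A B : set {ffun 'I_n -> G},
    algebraic A -> algebraic B -> algebraic (A `|` B).

End EquationalDomain.

Section ConjugatelySeparatedNilpotent.
Variable G : groupType.

Definition is_subgroup (H : set G) : Prop :=
  [/\ H 1, forall x y, H x -> H y -> H (x * y) & forall x, H x -> H x^-1].

Definition conj_set (H : set G) (x : G) : set G := [set h ^ x | h in H].

Definition malnormal (H : set G) : Prop :=
  forall x, ~ H x -> H `&` conj_set H x = [set 1].

(* foldl commg x [:: y_1; ...; y_k] is the left-normed commutator
   [x, y_1, ..., y_k] of weight k + 1. *)
Definition nilpotent_of_class (k : nat) (H : set G) : Prop :=
  forall (x : G) (s : k.-tuple G),
    H x -> (forall i, H (tnth s i)) -> foldl commg x s = 1.

Definition nilpotent_subgroup (k : nat) (H : set G) : Prop :=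
  is_subgroup H /\ nilpotent_of_class k H.

Definition maximal_nilpotent_subgroup (k : nat) (M : set G) : Prop :=
  nilpotent_subgroup k M /\
  forall H : set G, nilpotent_subgroup k H -> M `<=` H -> H = M.

Definition CSN (k : nat) : Prop :=
  forall M : set G, maximal_nilpotent_subgroup k M -> malnormal M.

Definition nilpotent_group : Prop :=
  exists2 c : nat, (0 < c)%N & nilpotent_of_class c [set: G].

End ConjugatelySeparatedNilpotent.

(* Main.v *)
Require Import Defs.
From mathcomp Require Import all_boot.
From mathcomp Require Import boolp classical_sets.

Set Implicit Arguments.
Unset Strict Implicit.
Unset Printing Implicit Defensive.

Local Open Scope classical_set_scope.
Local Open Scope group_scope.

(** If [x] and [y] are nontrivial and [x] commutes with every conjugate of [y],
    take a maximal class [k] nilpotent subgroup [M] containing [x].  As [M] is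
    malnormal and every [y ^ g] centralizes [x], all conjugates of [y] lie in
    [M]; then [y ^ g] lies in both [M] and its conjugate by [g], so malnormality
    forces [g] into [M] and the group is nilpotent.  Hence some commutator
    [x, y ^ g] is nontrivial, and the union of the zero sets of [S] and [T] is
    cut out by the words [w, v ^ g] for [w] in [S], [v] in [T], [g] in [G]. *)

Section GroupMorphisms.
Variables (G H : groupType) (f : G -> H).
Hypothesis fM : {morph f : x y / x * y}.

Lemma morph_mul1 : f 1 = 1.
Proof. by apply: (mulgI (f 1)); rewrite -fM !mulg1. Qed.

Lemma morph_mulV : {morph f : x / x^-1}.
Proof. by move=> x; apply: (mulgI (f x)); rewrite -fM !mulgV morph_mul1. Qed.

Lemma morph_mulJ : {morph f : x y / x ^ y}.
Proof. by move=> x y; rewrite !conjgE !fM morph_mulV. Qed.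

Lemma morph_mulR : {morph f : x y / [~ x, y]}.
Proof. by move=> x y; rewrite !commgEl fM morph_mulV morph_mulJ. Qed.

End GroupMorphisms.

(** A zero divisor in a group is a nontrivial [x] that commutes with all conjugates of some
    nontrivial [y]. *)
Definition no_zero_divisors (G : groupType) : Prop :=
  forall x y : G, x <> 1 -> y <> 1 -> exists g, [~ x, y ^ g] <> 1.

Lemma no_zero_divisors_equational_domain (G : groupType) :
  no_zero_divisors G -> equational_domain G.
Proof.
move=> nzd n _ _ _ [S ->] [T ->].
exists [set u | exists w v g,
  [/\ S w, T v & u = [~ w, v ^ coefficient n g]]].
apply/seteqP; split=> p.
  move=> pST _ [w [v [g [Sw Tv ->]]]].
  have pM := word_valueM p; rewrite (morph_mulR pM) (morph_mulJ pM).
  by case: pST => [/(_ _ Sw)|/(_ _ Tv)] ->; rewrite ?conj1g ?comm1g ?commg1.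
move=> pU; apply: contrapT => /not_orP[].
move=> /existsNP[w /not_implyP[Sw w1]] /existsNP[v /not_implyP[Tv v1]].
have [g] := nzd _ _ w1 v1; apply.
have pM := word_valueM p; have := pU [~ w, v ^ coefficient n g].
rewrite (morph_mulR pM) (morph_mulJ pM) word_value_coefficient.
by apply; exists w, v, g.
Qed.

(** Induction on [s], keeping the larger of two comparable members at each step. The base member
    [X0] settles the empty sequence. *)
Lemma subset_chain_seq (T : eqType) (F : set (set T)) (X0 : set T)
    (s : seq T) :
  total_on F subset -> F X0 ->
  (forall x, x \in s -> (\bigcup_(X in F) X) x) ->
  exists X, [/\ F X, X0 `<=` X & forall x, x \in s -> X x].
Proof.
move=> Ftot FX0; elim: s => [|x s IH] Fs; first by exists X0; split.
have [y ys|X [FX sX0X Xs]] := IH; first by apply: Fs; rewrite inE ys orbT.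
have [Y FY Yx] := Fs x (mem_head x s).
have [sXY|sYX] := Ftot _ _ FX FY.
  exists Y; split=> // [|y]; first exact: subset_trans sXY.
  by rewrite inE => /predU1P[-> //|/Xs/sXY].
exists X; split=> // y.
by rewrite inE => /predU1P[->|/Xs //]; apply: sYX.
Qed.

Section NilpotentSubgroups.
Variables (G : groupType) (k : nat).

Lemma abelian_nilpotent_of_class (A : set G) : (0 < k)%N ->
  (forall x y, A x -> A y -> commute x y) -> nilpotent_of_class k A.
Proof.
move=> k_gt0 cA x s Ax As.
have fold1 (t : seq G) : foldl commg 1 t = 1.
  by elim: t => //= y t IH; rewrite comm1g.
case: s As => -[|y s] /= sz As; first by rewrite -(eqP sz) in k_gt0.
have /cA/(_ Ax) yx : A y.
  by have := As (Ordinal k_gt0); rewrite (tnth_nth 1).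
by have /commgP/eqP -> : commute x y by exact: commute_sym.
Qed.

(** The subgroup laws and the class [k] identity each involve finitely many elements, and these
    already lie in a single member of the chain. *)
Lemma nilpotent_subgroup_bigcup (F : set (set G)) : F !=set0 ->
  total_on F subset -> F `<=` nilpotent_subgroup k ->
  nilpotent_subgroup k (\bigcup_(X in F) X).
Proof.
move=> [X0 FX0] Ftot Fnil; split; first split.
- by exists X0 => //; have [[]] := Fnil _ FX0.
- move=> x y Ux Uy.
  have [z|X [FX _ Xxy]] := @subset_chain_seq _ F X0 [:: x; y] Ftot FX0.
    by rewrite !inE => /orP[]/eqP ->.
  exists X => //; have [[_ XM _] _] := Fnil _ FX.
  by apply: XM; apply: Xxy; rewrite !inE eqxx ?orbT.
- by move=> x [X FX Xx]; exists X => //; have [[_ _ XV] _] := Fnil _ FX; apply: XV.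
move=> x s [X FX Xx] Us.
have [z /tnthP[i ->] //|Y [FY sXY Ys]] := subset_chain_seq (s := s) Ftot FX.
have [_ Ynil] := Fnil _ FY.
by apply: Ynil => [|i]; [apply: sXY|apply/Ys/mem_tnth].
Qed.

(* [Zorn_bigcup] also asks for the empty chain, so the empty set is let in. *)
Lemma nilpotent_subgroup_sub_maximal (H : set G) : nilpotent_subgroup k H ->
  exists2 M, maximal_nilpotent_subgroup k M & H `<=` M.
Proof.
move=> Hnil.
pose P (A : set G) := A !=set0 -> nilpotent_subgroup k A /\ H `<=` A.
have [F FP Ftot|M [PM maxM]] := @Zorn_bigcup _ P.
  move=> [x [X0 FX0 X0x]].
  (* [P] says nothing about the empty set, so it is dropped from the chain; the union does not
     change. *)
  pose F' := F `&` [set A | A !=set0].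
  have FX0' : F' X0 by split=> //; exists x.
  have -> : \bigcup_(X in F) X = \bigcup_(X in F') X.
    apply/seteqP; split=> y [X FX Xy]; exists X => //; first by split=> //; exists y.
    by case: FX.
  split.
    apply: nilpotent_subgroup_bigcup; first by exists X0.
      by move=> X Y [FX _] [FY _]; apply: Ftot.
    by move=> X [/FP PX X0']; have [] := PX X0'.
  have [_ sHX] := FP _ FX0 (ex_intro _ x X0x).
  by move=> y /sHX X0y; exists X0.
have H1 : H 1 by case: Hnil => -[].
have M0 : M !=set0.
  (* If [M] were empty, [H] would satisfy [P] and strictly contain it. *)
  apply: contrapT => M0; apply: (maxM H); last by split.
  split=> [x Mx|HM]; first by case: M0; exists x.
  by apply: M0; exists 1; apply: HM.
have [Mnil sHM] := PM M0; exists M => //; split=> // K Knil sMK.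
apply: contrapT => KM; apply: (maxM K).
  by split=> // sKM; apply: KM; apply/seteqP.
by move=> _; split=> //; apply: subset_trans sMK.
Qed.

(* The double centralizer of [x] is an abelian subgroup. *)
Lemma mem_maximal_nilpotent_subgroup (x : G) : (0 < k)%N ->
  exists2 M, maximal_nilpotent_subgroup k M & M x.
Proof.
move=> k_gt0; pose Z := [set z | forall c, commute c x -> commute c z].
have Zx : Z x by [].
have [|M maxM sZM] := @nilpotent_subgroup_sub_maximal Z.
  split; last first.
    (* As [x] commutes with itself, [y] commutes with [x], and hence with [z]. *)
    apply: abelian_nilpotent_of_class => // y z Zy Zz.
    by apply: Zz; apply/commute_sym/Zy.
  split=> [c _|y z Zy Zz c cx|y Zy c cx]; first exact: commute1.
    by apply: commuteM; [apply: Zy|apply: Zz].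
  by apply: commuteV; apply: Zy.
by exists M => //; apply: sZM.
Qed.

(** Otherwise [x ^ g] would be a nontrivial element of [M] and of its conjugate by [g]. *)
Lemma malnormal_mem (M : set G) (x g : G) :
  malnormal M -> x <> 1 -> M x -> M (x ^ g) -> M g.
Proof.
move=> malM x1 Mx Mxg; apply: contrapT => /malM MMg.
have : (M `&` conj_set M g) (x ^ g) by split=> //; exists x.
by rewrite MMg => /= /eqP; rewrite conjg_eq1 => /eqP.
Qed.

Lemma CSN_no_zero_divisors :
  (0 < k)%N -> CSN G k -> ~ nilpotent_group G -> no_zero_divisors G.
Proof.
move=> k_gt0 csn Gnil x y x1 y1; apply: contrapT => /forallNP xy.
have [M maxM Mx] := mem_maximal_nilpotent_subgroup x k_gt0.
have malM := csn M maxM.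
have MyG g : M (y ^ g).
  (* Here the conjugating element is [y ^ g] itself, and it fixes [x]. *)
  apply: (malnormal_mem malM x1 Mx).
  by have /eqP/conjg_fixP -> : [~ x, y ^ g] = 1 by apply: contrapT (xy g).
have My : M y by rewrite -[y]conjg1.
have MT g : M g := malnormal_mem malM y1 My (MyG g).
case: Gnil; exists k => // z s _ _.
by have [[_ Mnil] _] := maxM; apply: Mnil.
Qed.

End NilpotentSubgroups.

Theorem theorem2 (G : groupType) (k : nat) :
  (0 < k)%N -> CSN G k -> ~ nilpotent_group G -> equational_domain G.
Proof.
move=> k_gt0 csn Gnil.
exact/no_zero_divisors_equational_domain/(CSN_no_zero_divisors k_gt0).
Qed.
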